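(* There exists a constant $\rho>0$ with the following property: for any real numbers $\ell,u$ with $11<\ell<u$ and $\frac{22}{50}<\frac{\ell}{u}<\frac{28}{50}$, any $n\in\mathbb{N}$, any $\mathbf{a}\in\mathsf{R}(n)$, and any $z\in S_n(\mathbf{a};\ell,u)$, the disc $\mathbb{D}(z;\rho\,|S_n(\mathbf{a};\ell,u)|)$ intersects at most two sets of the form $S_n(\mathbf{c};\ell,u)$ with $\mathbf{c}\in\mathsf{R}(n)$.
   Context: $\|z\|:=\max\{|\Re z|,|\Im z|\}$, $\mathscr{D}:=\{a\in\mathbb{Z}[i]:|a|\geq\sqrt2\}$. Let $[z]:=\lfloor \Re z+\tfrac12\rfloor+i\lfloor \Im z+\tfrac12\rfloor$, $\mathfrak{F}:=\{z\in\mathbb{C}:[z]=0\}$, $T(z)=z^{-1}-[z^{-1}]$ ($z\ne0$), $T(0)=0$, Hurwitz partial quotients $a_1(z)=[z^{-1}]$, $a_n(z)=a_1(T^{n-1}z)$. The cylinder of $(a_1,\dots,a_n)\in\mathscr{D}^n$ is $\mathcal{C}_n(a_1,\dots,a_n)=\{z\in\mathfrak{F}:a_j(z)=a_j,1\le j\le n\}$; $\mathsf{R}(n)$ is the set of words whose cylinder has non-empty interior. For $\mathbf{a}\in\mathsf{R}(n)$ and $0<\ell<u$, \[ S_n(\mathbf{a};\ell,u):=\bigcup_{\substack{d\in\mathscr{D},\ \ell\le\|d\|\le u\\ \mathbf{a}d\in\mathsf{R}(n+1)}}\overline{\mathcal{C}_{n+1}(\mathbf{a}d)}. \] $|A|$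 denotes diameter and $\mathbb{D}(z;r)$ the open disc. *)

(* Defs.v *)
From HB Require Import structures.
From mathcomp Require Import all_boot all_order all_algebra.
From mathcomp Require Import all_classical all_reals all_analysis.
From mathcomp Require Import complex.

Set Implicit Arguments.
Unset Strict Implicit.
Unset Printing Implicit Defensive.

Import Order.TTheory GRing.Theory Num.Theory.
Import numFieldNormedType.Exports.
Import Normc.

Local Open Scope classical_set_scope.
Local Open Scope ring_scope.
Local Open Scope complex_scope.

Section HurwitzContinuedFractions.
Variable R : realType.

(* The type [R[i]] itself carries no topology; sets of complex numbers are sets
   over its convertible alias [R[i]^o], whose topology is the one induced by the
   modulus.  [normc] is the modulus with values in [R]. *)

Definition supnorm (z : R[i]) : R := Num.max `|complex.Re z| `|complex.Im z|.

Definition gaussian_int : set R[i] :=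
  [set a | complex.Re a \is a Num.int /\ complex.Im a \is a Num.int].

Definition digit : set R[i] :=
  [set a | gaussian_int a /\ Num.sqrt 2 <= normc a].

Definition nearest_gaussian (z : R[i]) : R[i] :=
  (Num.floor (complex.Re z + 2^-1))%:~R +i* (Num.floor (complex.Im z + 2^-1))%:~R.

Definition fundamental_domain : set R[i]^o :=
  [set z : R[i]^o | nearest_gaussian z = 0].

Definition hurwitz_map (z : R[i]) : R[i] :=
  if z == 0 then 0 else z^-1 - nearest_gaussian z^-1.

(* [partial_quotient n z] is $a_n(z)$, for n >= 1.  Since [0^-1 = 0], it is 0
   when $T^{n-1} z = 0$, where $a_n(z)$ is undefined; as 0 is not a digit, such
   z lie in no cylinder of a word of digits of length at least n. *)
Definition partial_quotient (n : nat) (z : R[i]) : R[i] :=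
  nearest_gaussian (iter n.-1 hurwitz_map z)^-1.

Definition cylinder (n : nat) (a : n.-tuple R[i]) : set R[i]^o :=
  [set z : R[i]^o | fundamental_domain z /\
     forall j : 'I_n, partial_quotient j.+1 z = tnth a j].

Definition regular_word (n : nat) : set (n.-tuple R[i]) :=
  [set a | (forall j : 'I_n, digit (tnth a j)) /\ interior (cylinder a) !=set0].

Definition annular_union (n : nat) (a : n.-tuple R[i]) (l u : R) : set R[i]^o :=
  \bigcup_(d in [set d : R[i] | [/\ digit d, l <= supnorm d <= u &
                                    regular_word (rcons_tuple a d)]])
    closure (cylinder (rcons_tuple a d)).

(* [sup] is the least upper bound for non-empty bounded sets. *)
Definition diameter (A : set R[i]^o) : R :=
  sup [set normc (x - y) | x in A & y in A].

Definition disc (z : R[i]^o) (r : R) : set R[i]^o := ball z r%:C.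

End HurwitzContinuedFractions.

(* Main.v *)
Require Import Defs.
From HB Require Import structures.
From mathcomp Require Import all_boot all_order all_algebra.
From mathcomp Require Import all_classical all_reals all_analysis.
From mathcomp Require Import complex ring lra zify.
Set Implicit Arguments.
Unset Strict Implicit.
Unset Printing Implicit Defensive.
Import Order.TTheory GRing.Theory Num.Theory.
Import numFieldNormedType.Exports.
Local Open Scope classical_set_scope.
Local Open Scope ring_scope.
Local Open Scope complex_scope.

(* Let w be the remainder of a point z of the cylinder of a word of length n, with
   convergent r = p/q.  In the coordinate y = 1/w + theta, where |theta| < 2, one
   has z - r = +-1/(q^2 y), and the points of S_n lie where |y| is comparable to l.

   If two sets S_n come close to each other, then they have the same convergent:
   otherwise some point z in the cylinder of one word is very close to the
   convergent r of the other, of smaller denominator.  Along the expansion of z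
   the remainders of z then stay so close to those of r, up to the symmetries
   of the square, that each of the latter lies in the closed unit square (a fraction
   of denominator Q outside it is at distance at least 1/(2|Q|^2) from it); after n
   steps, the convergent of z is r.

   For words with the same convergent the coordinates y agree up to sign.  In this
   coordinate each cylinder is, near infinity, a plane, a half-plane or a
   quadrant with sides parallel to the axes.  Three such regions that meet far out in
   the same axis direction cannot have disjoint interiors. *)

(** * Coordinates, squared modulus and supremum norm of complex numbers *)

Section Complex.
Variable R : realType.
Implicit Types (z w x y c d : R[i]) (s : seq R[i]).
Local Notation Re := complex.Re.
Local Notation Im := complex.Im.

Lemma complexReD x y : Re (x + y) = Re x + Re y.
Proof. by case: x y => [? ?] [? ?]. Qed.
Lemma complexImD x y : Im (x + y) = Im x + Im y.
Proof. by case: x y => [? ?] [? ?]. Qed.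
Lemma complexReN x : Re (- x) = - Re x.
Proof. by case: x. Qed.
Lemma complexImN x : Im (- x) = - Im x.
Proof. by case: x. Qed.
Lemma complexReM x y : Re (x * y) = Re x * Re y - Im x * Im y.
Proof. by case: x y => [? ?] [? ?]. Qed.
Lemma complexImM x y : Im (x * y) = Re x * Im y + Im x * Re y.
Proof. by case: x y => [? ?] [? ?]. Qed.
Lemma complexReJ x : Re (conjc x) = Re x.
Proof. by case: x. Qed.
Lemma complexImJ x : Im (conjc x) = - Im x.
Proof. by case: x. Qed.

Definition ReImE := (complexReD, complexImD, complexReN, complexImN,
  complexReM, complexImM, complexReJ, complexImJ).

Definition sqnorm z : R := Re z ^+ 2 + Im z ^+ 2.

Lemma complexReV x : Re x^-1 = Re x / sqnorm x.
Proof. by case: x. Qed.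
Lemma complexImV x : Im x^-1 = - Im x / sqnorm x.
Proof. by case: x => a b; rewrite /= mulNr. Qed.

Lemma complex_ext x y : Re x = Re y -> Im x = Im y -> x = y.
Proof. by case: x y => [? ?] [? ?] /= -> ->. Qed.

Lemma sqnorm_ge0 z : 0 <= sqnorm z.
Proof. by rewrite addr_ge0 // sqr_ge0. Qed.

Lemma sqnorm_eq0 z : (sqnorm z == 0) = (z == 0).
Proof. by rewrite paddr_eq0 ?sqr_ge0 // !sqrf_eq0 eq_complex. Qed.

Lemma sqnorm_gt0 z : (0 < sqnorm z) = (z != 0).
Proof. by rewrite lt0r sqnorm_eq0 sqnorm_ge0 andbT. Qed.

Lemma sqnormM x y : sqnorm (x * y) = sqnorm x * sqnorm y.
Proof. by rewrite /sqnorm !ReImE; ring. Qed.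

Lemma sqnormN x : sqnorm (- x) = sqnorm x.
Proof. by rewrite /sqnorm !ReImE !sqrrN. Qed.

Lemma sqnormJ x : sqnorm (conjc x) = sqnorm x.
Proof. by rewrite /sqnorm !ReImE sqrrN. Qed.

Lemma sqnorm1 : sqnorm 1 = 1.
Proof. by rewrite /sqnorm /= expr1n expr0n addr0. Qed.

Lemma sqnormV x : sqnorm x^-1 = (sqnorm x)^-1.
Proof.
have [->|x0] := eqVneq x 0.
  by rewrite invr0 (eqP (_ : sqnorm 0 == 0)) ?invr0 // sqnorm_eq0.
apply: (mulIf (_ : sqnorm x != 0)); first by rewrite sqnorm_eq0.
by rewrite -sqnormM !mulVf ?sqnorm1 // sqnorm_eq0.
Qed.

Lemma normc_sqnorm z : Normc.normc z = Num.sqrt (sqnorm z).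
Proof. by case: z. Qed.

Lemma sqr_normc z : Normc.normc z ^+ 2 = sqnorm z.
Proof. by rewrite normc_sqnorm sqr_sqrtr // sqnorm_ge0. Qed.

Lemma normc_ge0 z : 0 <= Normc.normc z.
Proof. by rewrite normc_sqnorm sqrtr_ge0. Qed.

Lemma normc_gt0 z : (0 < Normc.normc z) = (z != 0).
Proof. by rewrite normc_sqnorm sqrtr_gt0 sqnorm_gt0. Qed.

Lemma normcD x y : Normc.normc (x + y) <= Normc.normc x + Normc.normc y.
Proof. exact: le_normcD. Qed.

Lemma normc_opp x : Normc.normc (- x) = Normc.normc x.
Proof. exact: normcN. Qed.

Lemma normcBC x y : Normc.normc (x - y) = Normc.normc (y - x).
Proof. by rewrite -normc_opp opprB. Qed.

Lemma normcB_le x y : Normc.normc x - Normc.normc y <= Normc.normc (x - y).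
Proof. by rewrite lerBlDr -{1}(subrK y x) normcD. Qed.

Lemma Re_le_normc z : `|Re z| <= Normc.normc z.
Proof. by rewrite normc_sqnorm -sqrtr_sqr ler_sqrt ?sqnorm_ge0 // lerDl sqr_ge0. Qed.

Lemma Im_le_normc z : `|Im z| <= Normc.normc z.
Proof. by rewrite normc_sqnorm -sqrtr_sqr ler_sqrt ?sqnorm_ge0 // lerDr sqr_ge0. Qed.

Lemma supnorm_le_normc z : supnorm z <= Normc.normc z.
Proof. by rewrite ge_max Re_le_normc Im_le_normc. Qed.

Lemma supnormD x y : supnorm (x + y) <= supnorm x + supnorm y.
Proof.
rewrite /supnorm !ReImE ge_max; apply/andP; split;
  (apply: le_trans (ler_normD _ _) _; apply: lerD); by rewrite le_max lexx ?orbT.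
Qed.

Lemma supnormN x : supnorm (- x) = supnorm x.
Proof. by rewrite /supnorm !ReImE !normrN. Qed.

Lemma sqnorm_le_supnorm z : sqnorm z <= 2 * supnorm z ^+ 2.
Proof.
have Hr : `|Re z| <= supnorm z by rewrite le_max lexx.
have Hi : `|Im z| <= supnorm z by rewrite le_max lexx orbT.
rewrite /sqnorm -(real_normK (num_real (Re z))) -(real_normK (num_real (Im z))).
rewrite mulr2n mulrDl !mul1r.
by apply: lerD; rewrite ler_pXn2r // nnegrE // (le_trans _ Hr).
Qed.

Lemma normc_le_supnorm z : Normc.normc z <= 3 / 2 * supnorm z.
Proof.
have := sqnorm_le_supnorm z; rewrite -sqr_normc.
have h0 : 0 <= supnorm z by rewrite le_max normr_ge0.
have := normc_ge0 z; nra.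
Qed.

End Complex.

(** * Gaussian integers and Hurwitz expansions of points *)

Section Expansion.
Variable R : realType.
Implicit Types (z w x y c d : R[i]) (s : seq R[i]).
Local Notation Re := complex.Re.
Local Notation Im := complex.Im.

Lemma int_lt1_le0 (m : R) : m \is a Num.int -> m < 1 -> m <= 0.
Proof. by move=> /intrP[k ->]; rewrite -[1]/(1%:~R) ltr_int -[0]/(0%:~R) ler_int; lia. Qed.

Lemma int_gt0_ge1 (m : R) : m \is a Num.int -> 0 < m -> 1 <= m.
Proof. by move=> /intrP[k ->]; rewrite -[1]/(1%:~R) -[0]/(0%:~R) ltr_int ler_int; lia. Qed.

Lemma gaussianD x y : gaussian_int x -> gaussian_int y -> gaussian_int (x + y).
Proof. by move=> [? ?] [? ?]; split; rewrite ReImE rpredD. Qed.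

Lemma gaussianN x : gaussian_int x -> gaussian_int (- x).
Proof. by move=> [? ?]; split; rewrite ReImE rpredN. Qed.

Lemma gaussianB x y : gaussian_int x -> gaussian_int y -> gaussian_int (x - y).
Proof. by move=> ? ?; apply/gaussianD/gaussianN. Qed.

Lemma gaussianM x y : gaussian_int x -> gaussian_int y -> gaussian_int (x * y).
Proof.
by move=> [? ?] [? ?]; split; rewrite ReImE ?rpredB ?rpredD // rpredM.
Qed.

Lemma gaussianJ x : gaussian_int x -> gaussian_int (conjc x).
Proof. by move=> [? ?]; split; rewrite ReImE ?rpredN. Qed.

Lemma gaussian0 : gaussian_int (0 : R[i]).
Proof. by split; rewrite /= rpred0. Qed.

Lemma gaussian1 : gaussian_int (1 : R[i]).
Proof. by split; rewrite /= ?rpred0 ?rpred1. Qed.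

Lemma gaussian_sqnorm_int x : gaussian_int x -> sqnorm x \is a Num.int.
Proof. by move=> [? ?]; rewrite rpredD // rpredX. Qed.

Lemma gaussian_sqnorm_ge1 x : gaussian_int x -> x != 0 -> 1 <= sqnorm x.
Proof. by move=> /gaussian_sqnorm_int xi x0; rewrite int_gt0_ge1 ?sqnorm_gt0. Qed.

Lemma gaussian_nearest x : gaussian_int (nearest_gaussian x).
Proof. by split; rewrite /= intr_int. Qed.

Lemma fundamentalP z : fundamental_domain z <->
  (- 2^-1 <= Re z < 2^-1 /\ - 2^-1 <= Im z < 2^-1).
Proof.
have aux (t : R) : (Num.floor (t + 2^-1))%:~R = 0 :> R <-> - 2^-1 <= t < 2^-1.
  split=> [/eqP|H]; last first.
    apply/eqP; rewrite intr_eq0 floor_eq /=; lra.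
  rewrite intr_eq0 floor_eq /= => H; lra.
split=> [[] /aux ? /aux ?//|[/aux h1 /aux h2]].
by rewrite /fundamental_domain /= /nearest_gaussian h1 h2.
Qed.

Lemma nearestP x d : nearest_gaussian x = d <->
  gaussian_int d /\ fundamental_domain (x - d).
Proof.
have aux (t m : R) : m \is a Num.int ->
    (Num.floor (t + 2^-1))%:~R = m :> R <-> - 2^-1 <= t - m < 2^-1.
  move=> /intrP[k ->]; split=> [/eqP|H]; last first.
    apply/eqP; rewrite eqr_int floor_eq intrD; lra.
  rewrite eqr_int floor_eq intrD => H; lra.
split=> [<-|[[rd id] /fundamentalP]].
  split; first exact: gaussian_nearest.
  by apply/fundamentalP; rewrite !ReImE /=; split; apply/aux => //; rewrite intr_int.
rewrite !ReImE => -[/aux-/(_ rd) h1 /aux-/(_ id) h2].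
by case: d h1 h2 {rd id} => dr di /= h1 h2; rewrite /nearest_gaussian h1 h2.
Qed.

(** The conditions on the partial quotients, peeled off digit by digit so that induction on the word
    applies; zero is excluded wherever a digit remains to be read. *)
Fixpoint expands s z : Prop := fundamental_domain z /\
  if s is d :: s' then
    [/\ z != 0, nearest_gaussian z^-1 = d & expands s' (z^-1 - d)]
  else True.

Fixpoint remainder s z : R[i] :=
  if s is d :: s' then remainder s' (z^-1 - d) else z.

Lemma digit_neq0 d : digit d -> d != 0.
Proof.
move=> [_ h]; apply: contraTneq h => ->.
by rewrite Normc.normc0 -ltNge sqrtr_gt0.
Qed.

Lemma digit_sqnorm d : digit d -> 2 <= sqnorm d.
Proof.
by move=> [_]; rewrite normc_sqnorm ler_sqrt // sqnorm_ge0.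
Qed.

Lemma expandsP s z : {in s, forall d, digit d} ->
  (fundamental_domain z /\
   forall j, (j < size s)%N -> partial_quotient j.+1 z = nth 0 s j) <->
  expands s z.
Proof.
elim: s z => [|d s IH] z sd /=; first by split=> -[].
have dd : digit d by apply: sd; rewrite inE eqxx.
have {}IH := IH (z^-1 - d) (fun c cs => sd c (mem_behead (s := d :: s) cs)).
split=> [[Fz h]|[Fz [z0 zd /IH[Fz' h]]]].
  have zd : nearest_gaussian z^-1 = d := h 0%N isT.
  (* Since the inverse of 0 is 0, a zero remainder would give the partial quotient 0, which is not a
     digit. *)
  have z0 : z != 0.
    apply: contraTneq (digit_neq0 dd) => z0; rewrite -zd z0 invr0 negbK.
    apply/eqP/nearestP; split; first exact: gaussian0.
    by apply/fundamentalP; rewrite !ReImE /=; lra.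
  split=> //; split=> //; apply/IH; split.
    by have /nearestP[] := zd.
  move=> j js; rewrite -[nth _ _ _]/(nth 0 (d :: s) j.+1) -(h j.+1 js).
  rewrite /partial_quotient -[j.+2.-1]/(j.+1) iterSr.
  by rewrite /hurwitz_map (negbTE z0) zd.
split=> // -[_|j js]; first exact: zd.
rewrite -[nth _ _ _]/(nth 0 s j) -h // /partial_quotient -[j.+2.-1]/(j.+1) iterSr.
by rewrite /hurwitz_map (negbTE z0) zd.
Qed.

Lemma cylinder_expands n (a : n.-tuple R[i]) z :
  (forall j, digit (tnth a j)) -> cylinder a z <-> expands a z.
Proof.
move=> da; rewrite -expandsP; last by move=> d /tnthP[j ->].
split=> -[Fz h]; split=> // j.
  rewrite size_tuple => jn; rewrite (h (Ordinal jn)).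
  by rewrite (tnth_nth 0).
by rewrite h ?size_tuple // (tnth_nth 0).
Qed.

Lemma expands_inj s1 s2 z : size s1 = size s2 ->
  expands s1 z -> expands s2 z -> s1 = s2.
Proof.
elim: s1 s2 z => [|d s IH] [|d2 s2] z //= [sz] [_ [_ zd h]] [_ [_ zd2 h2]].
by rewrite -zd -zd2; congr cons; apply: (IH _ _ sz h); rewrite -zd zd2.
Qed.

Lemma expands_rcons s d z : expands (rcons s d) z <->
  [/\ expands s z, remainder s z != 0, gaussian_int d &
      fundamental_domain ((remainder s z)^-1 - d)].
Proof.
elim: s z => [|c s IH] z /=.
  split=> [[Fz [z0 /nearestP[gd Fd] _]]//|[[Fz _] z0 gd Fd]].
  by split=> //; split=> //; apply/nearestP.
split=> [[Fz [z0 zd /IH[? ? ? ?]]]//|[[Fz [z0 zd h]] h0 gd Fd]].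
by split=> //; split=> //; apply/IH.
Qed.

Lemma expands_remainder s z : expands s z -> fundamental_domain (remainder s z).
Proof. by elim: s z => [|d s IH] z /= [Fz] // [_ _] /IH. Qed.

(** The inverse branch along [s] of an iterate of the Hurwitz map; its value at [w = 0] is the
    convergent. *)
Definition cfrac s w : R[i] := foldr (fun d v => (d + v)^-1) w s.

Lemma cfrac_rcons s d w : cfrac (rcons s d) w = cfrac s (d + w)^-1.
Proof. by rewrite /cfrac foldr_rcons. Qed.

Lemma cfrac_remainder s z : expands s z -> cfrac s (remainder s z) = z.
Proof.
elim: s z => [|d s IH] z //= [_ [_ _ /IH ->]].
by rewrite addrC subrK invrK.
Qed.

Lemma remainder_cfrac s w : expands s (cfrac s w) -> remainder s (cfrac s w) = w.
Proof.
elim: s => [|d s IH] //= [_ []].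
by rewrite invrK [d + _]addrC addrK => _ _ /IH.
Qed.

End Expansion.

(** * Continuants, and the Möbius map of a word near its convergent *)

Section Convergents.
Variable R : realType.
Implicit Types (z w x y c d v P Q : R[i]) (s a : seq R[i]).
Local Notation Re := complex.Re.
Local Notation Im := complex.Im.

Lemma supnorm_le x (b : R) : (supnorm x <= b) = (`|Re x| <= b) && (`|Im x| <= b).
Proof. by rewrite /supnorm ge_max. Qed.

Lemma fundamental_supnorm z : fundamental_domain z -> supnorm z <= 2^-1.
Proof. by move=> /fundamentalP h; rewrite supnorm_le !ler_norml; lra. Qed.

Lemma supnorm_half_sqnorm z : supnorm z <= 2^-1 -> sqnorm z <= 2^-1.
Proof. by rewrite supnorm_le /sqnorm !ler_norml => h; nra. Qed.

(** The continuant q of the word: q(d :: s) = d q(s) + p(s), with p(s)/q(s) = [cfrac s 0] factored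
    out. The numerator p is [den s * cfrac s 0]. *)
Fixpoint den s : R[i] := if s is d :: s' then den s' * (d + cfrac s' 0) else 1.

(** For reduced words this is the quotient of the last two continuants, q_{n-1}/q_n, expressed as an
    alternating sum over suffixes. It is the theta of the coordinate y = 1/w + theta. *)
Fixpoint shift s : R[i] :=
  if s is d :: s' then shift s' + (-1) ^+ size s' / (den s * den s') else 0.

(** The square is closed because the convergent of a regular word may fall on a side that the
    fundamental domain omits: the word with single digit 2 has convergent 1/2. *)
Fixpoint reduced s : Prop :=
  if s is d :: s' then
    [/\ digit d, supnorm (cfrac s 0) <= 2^-1 & reduced s']
  else True.

Lemma reduced_supnorm s : reduced s -> supnorm (cfrac s 0) <= 2^-1.
Proof. by case: s => [_|d s []//]; rewrite /= supnorm_le /= normr0; lra. Qed.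

Lemma digitD_neq0 d w : digit d -> supnorm w <= 2^-1 -> d + w != 0.
Proof.
move=> /digit_sqnorm dd /supnorm_half_sqnorm ww; rewrite addr_eq0.
by apply: contraTneq dd => ->; rewrite sqnormN -ltNge; lra.
Qed.

Lemma reduced_den_neq0 s : reduced s -> den s != 0.
Proof.
elim: s => [_|d s IH [dd _ rs]] /=; first exact: oner_neq0.
by rewrite mulf_neq0 ?IH // digitD_neq0 // reduced_supnorm.
Qed.

Lemma reduced_denM d s : reduced s -> digit d ->
  den (d :: s) * cfrac (d :: s) 0 = den s.
Proof.
move=> rs dd /=; rewrite mulfK // digitD_neq0 //.
exact: reduced_supnorm.
Qed.

Lemma gaussian_den s : reduced s ->
  gaussian_int (den s) /\ gaussian_int (den s * cfrac s 0).
Proof.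
elim: s => [_|d s IH [dd _ rs]].
  by rewrite /= mulr0; split; [exact: gaussian1|exact: gaussian0].
have [h1 h2] := IH rs; rewrite reduced_denM //; split=> //=.
by rewrite mulrDr; apply: gaussianD => //; apply: gaussianM => //; case: dd.
Qed.

(** The numerator of the longer convergent is the denominator of the shorter one, and a point p/q of
    the closed square has squared modulus at most 1/2. *)
Lemma den_sqnorm_cons d s : reduced (d :: s) ->
  2 * sqnorm (den s) <= sqnorm (den (d :: s)).
Proof.
move=> h; have [dd hs rs] := h; rewrite -(reduced_denM rs dd) sqnormM.
have := supnorm_half_sqnorm hs; have := sqnorm_ge0 (den (d :: s)); nra.
Qed.

Lemma normcV1 (x : R[i]) : Normc.normc x^-1 = (Normc.normc x)^-1.
Proof. exact: Normc.normcV. Qed.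

Lemma normc_sign n : Normc.normc ((-1) ^+ n : R[i]) = 1.
Proof.
elim: n => [|n IH]; first by rewrite expr0 Normc.normc1.
by rewrite exprS Normc.normcM IH normc_opp Normc.normc1 mulr1.
Qed.

Lemma normc_shift_step s d : digit d -> reduced s ->
  Normc.normc ((-1) ^+ size s / (den (d :: s) * den s)) =
    (Normc.normc (den (d :: s)) * Normc.normc (den s))^-1.
Proof. by move=> dd rs; rewrite Normc.normcM normc_sign mul1r normcV1 Normc.normcM. Qed.

(* The increment 1/|q q'| telescopes against 2/|q|^2 because |q'|^2 >= 2|q|^2. *)
Lemma shift_bound s : reduced s ->
  Normc.normc (shift s) <= 2 - 2 / sqnorm (den s).
Proof.
elim: s => [_|d s IH h].
  by rewrite [den _]/(1) sqnorm1 [Normc.normc _](Normc.normc0 R); lra.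
have [dd hs rs] := h; have {IH} := IH rs.
have /= := normcD (shift s) ((-1) ^+ size s / (den (d :: s) * den s)).
rewrite -[_ * (d + _)]/(den (d :: s)) normc_shift_step //.
have := den_sqnorm_cons h; rewrite -!sqr_normc.
have : 0 < Normc.normc (den s) by rewrite normc_gt0 reduced_den_neq0.
have : 0 < Normc.normc (den (d :: s)) by rewrite normc_gt0 reduced_den_neq0.
set A := Normc.normc (den (d :: s)); set B := Normc.normc (den s).
set T := Normc.normc (shift s); set U := Normc.normc _.
move=> A0 B0 AB h1 h2; apply: (le_trans h1).
have : (A * B)^-1 <= 2 / B ^+ 2 - 2 / A ^+ 2; last by lra.
rewrite -subr_ge0.
have -> : 2 / B ^+ 2 - 2 / A ^+ 2 - (A * B)^-1 =
   (2 * A ^+ 2 - 2 * B ^+ 2 - A * B) / (A ^+ 2 * B ^+ 2).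
  by field; rewrite !gt_eqF.
rewrite divr_ge0 ?mulr_ge0 ?sqr_ge0 //; nra.
Qed.

Lemma shift_lt2 s : reduced s -> Normc.normc (shift s) < 2.
Proof.
move=> rs; have := shift_bound rs.
have : 0 < 2 / sqnorm (den s) by rewrite divr_gt0 // sqnorm_gt0 reduced_den_neq0.
lra.
Qed.

(** The induction step of [cfrac_far], kept apart because [expands_reduced] applies it to a word not
    yet known to be reduced. *)
Lemma cfrac_far_step d r e Q Y : d + r != 0 -> Q != 0 -> Y != 0 ->
  Y + e / (Q * (d + r) * Q) != 0 ->
  (d + (r + e / (Q ^+ 2 * Y)))^-1 =
  (d + r)^-1 - e / ((Q * (d + r)) ^+ 2 * (Y + e / (Q * (d + r) * Q))).
Proof.
move=> dr Q0 Y0 Y1; set Z := Y + _ in Y1 *.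
have -> : d + (r + e / (Q ^+ 2 * Y)) = (d + r) * Z / Y.
  by rewrite /Z; field; rewrite dr Q0 Y0.
have -> : e = (Z - Y) * (Q * (d + r) * Q).
  by rewrite /Z; field; rewrite dr Q0.
by field; rewrite dr Q0 Y0 Y1.
Qed.

Lemma normcD_neq0 x y : Normc.normc y < Normc.normc x -> x + y != 0.
Proof. by move=> h; rewrite addr_eq0; apply: contraTneq h => ->; rewrite normc_opp ltxx. Qed.

(* Near its convergent, the Möbius map of [s] is an inversion in the coordinate
   [v + shift s], where [v] is the inverse of the remainder. *)
Lemma cfrac_far s v : reduced s -> 2 <= Normc.normc v ->
  cfrac s v^-1 = cfrac s 0 + (-1) ^+ size s / (den s ^+ 2 * (v + shift s)).
Proof.
move=> + v2; elim: s => [_|d s IH h].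
  by rewrite /= expr0 expr1n !mul1r add0r addr0.
have [dd hs rs] := h; have -> : cfrac (d :: s) v^-1 = (d + cfrac s v^-1)^-1 by [].
rewrite IH //.
have v0 : v + shift s != 0 by rewrite normcD_neq0 // (lt_le_trans (shift_lt2 rs)).
have v1 := normcD_neq0 (lt_le_trans (shift_lt2 h) v2).
rewrite cfrac_far_step ?reduced_den_neq0 //.
- have -> : size (d :: s) = (size s).+1 by [].
  by rewrite [(-1) ^+ _.+1]exprS mulN1r mulNr -addrA.
- by rewrite digitD_neq0 // reduced_supnorm.
- by rewrite -addrA.
Qed.

(** The ends of the interval, -1/2 and 1/2, are themselves multiples of 1/(2N); a multiple at
    distance less than one grid step from the interval therefore lies in it. *)
Lemma half_grid (x t N m : R) : N \is a Num.int -> m \is a Num.int -> 1 <= N ->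
  2 * N * t = m -> `|x| <= 2^-1 -> 2 * N * `|x - t| < 1 -> `|t| <= 2^-1.
Proof.
move=> Ni mi N1 Nt x2 xt.
have {}xt : `|2 * N * (x - t)| < 1.
  by rewrite normrM ger0_norm //; lra.
have x3 : `|2 * N * x| <= N.
  by rewrite normrM ger0_norm; [nra|lra].
have m1 : m <= N.
  rewrite -subr_le0 int_lt1_le0 ?rpredB // -Nt.
  by move: xt x3; rewrite ltr_norml ler_norml; lra.
have m2 : - m <= N.
  rewrite -subr_le0 int_lt1_le0 ?rpredB ?rpredN // -Nt.
  by move: xt x3; rewrite ltr_norml ler_norml; lra.
by rewrite ler_norml; apply/andP; split; nra.
Qed.

(** Since w |Q|^2 = P conj(Q) is a Gaussian integer, both coordinates of w lie on the grid of
    [half_grid] with N = |Q|^2. *)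
Lemma supnorm_grid z w P Q : gaussian_int P -> gaussian_int Q -> Q != 0 ->
  w * Q = P -> supnorm z <= 2^-1 -> 2 * sqnorm Q * Normc.normc (z - w) < 1 ->
  supnorm w <= 2^-1.
Proof.
move=> gP gQ Q0 wQ; rewrite !supnorm_le => /andP[zr zi] close.
have NQ := gaussian_sqnorm_int gQ; have NQ1 := gaussian_sqnorm_ge1 gQ Q0.
have wE : w * (sqnorm Q)%:C = P * (conjc Q).
  rewrite -wQ; apply: complex_ext; rewrite !ReImE /sqnorm /=; ring.
have [hr hi] := gaussianM gP (gaussianJ gQ).
have two : (2 : R) \is a Num.int by rewrite -[2]/(2%:R) natr_int.
have N2 : 0 <= 2 * sqnorm Q by lra.
apply/andP; split.
  apply: (half_grid (N := sqnorm Q) NQ (rpredM two hr) NQ1 _ zr).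
    by rewrite -wE !ReImE /=; ring.
  apply: le_lt_trans close; apply: ler_wpM2l => //.
  by have := Re_le_normc (z - w); rewrite !ReImE.
apply: (half_grid (N := sqnorm Q) NQ (rpredM two hi) NQ1 _ zi).
  by rewrite -wE !ReImE /=; ring.
apply: le_lt_trans close; apply: ler_wpM2l => //.
by have := Im_le_normc (z - w); rewrite !ReImE.
Qed.

(** Going from shorter to longer suffixes, the point and the convergent differ by 1/(|q|^2 |v +
    theta|) with |v + theta| > 2, which is below the threshold of [supnorm_grid]. *)
Lemma expands_reduced s v : {in s, forall d, digit d} ->
  expands s (cfrac s v^-1) -> 5 <= Normc.normc v -> reduced s.
Proof.
move=> + + v5; elim: s => [//|d s IH] sd [Fx [x0 xd hx]].
rewrite -/cfrac in x0 xd hx.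
have dd : digit d by apply: sd; rewrite inE eqxx.
have rs : reduced s.
  apply: IH => [c cs|]; first by apply: sd; rewrite inE cs orbT.
  by move: hx; rewrite /= invrK addrC addKr.
split=> //.
have dr := digitD_neq0 dd (reduced_supnorm rs).
have Q0 := reduced_den_neq0 rs.
have [gQ gP] := gaussian_den rs.
have gQ' : gaussian_int (den (d :: s)).
  by rewrite /= mulrDr; apply: gaussianD => //; apply: gaussianM => //; case: dd.
have Q'0 : den (d :: s) != 0 by rewrite /= mulf_neq0.
apply: (supnorm_grid (z := cfrac (d :: s) v^-1) (Q := den (d :: s)) gQ gQ') => //.
- by rewrite mulrC reduced_denM.
- exact: fundamental_supnorm.
have T2 := shift_lt2 rs.
have T3 := normc_shift_step dd rs.
have A1 : 1 <= Normc.normc (den (d :: s)) ^+ 2 by rewrite sqr_normc gaussian_sqnorm_ge1.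
have B1 : 1 <= Normc.normc (den s) ^+ 2 by rewrite sqr_normc gaussian_sqnorm_ge1.
have A0 := normc_ge0 (den (d :: s)); have B0 := normc_ge0 (den s).
have {}A0 : 1 <= Normc.normc (den (d :: s)).
  by move: (Normc.normc _) A0 A1 => A A0 A1; nra.
have {}B0 : 1 <= Normc.normc (den s).
  by move: (Normc.normc (den s)) B0 B1 => B B0 B1; nra.
have T4 : Normc.normc ((-1) ^+ size s / (den (d :: s) * den s)) <= 1.
  rewrite T3 invf_le1 ?mulr_gt0 ?(lt_le_trans ltr01) //.
  by rewrite -[1]mulr1 ler_pM.
(* The bound 2 is known only for the suffix [s]; one more term adds at most 1. This is why [v] has
   modulus at least 5. *)
have T5 : Normc.normc (shift (d :: s)) < 3.
  by rewrite /=; apply: le_lt_trans (normcD _ _) _; move: T4 => /=; lra.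
have Y0 : v + shift (d :: s) != 0 by rewrite normcD_neq0 //; lra.
rewrite /= (cfrac_far rs); last by lra.
rewrite cfrac_far_step //; first last.
- by rewrite -addrA.
- by rewrite normcD_neq0 //; lra.
rewrite -(addrA v) -[_ * (d + _)]/(den (d :: s)) -[shift s + _]/(shift (d :: s)).
rewrite addrAC subrr sub0r normc_opp Normc.normcM normc_sign mul1r normcV1 Normc.normcM.
have Y2 : 2 < Normc.normc (v + shift (d :: s)).
  by have := normcB_le v (- shift (d :: s)); rewrite opprK normc_opp; lra.
rewrite exprS expr1 Normc.normcM -!expr2 -sqr_normc -mulrA mulrC.
rewrite invfM mulrA mulfV ?mul1r; last by rewrite sqr_normc sqnorm_eq0.
by rewrite mulrC ltr_pdivrMr; lra.
Qed.

End Convergents.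

(** * Nearby convergents coincide; their denominators agree up to a unit *)

Section Uniqueness.
Variable R : realType.
Implicit Types (z w x y c d e f v P Q : R[i]) (s a : seq R[i]).
Local Notation Re := complex.Re.
Local Notation Im := complex.Im.

(** Same orbit under the dihedral group of the square. *)
Definition square_sym x y : Prop :=
  (`|Re x| = `|Re y| /\ `|Im x| = `|Im y|) \/
  (`|Re x| = `|Im y| /\ `|Im x| = `|Re y|).

Lemma square_sym_supnorm x y : square_sym x y -> supnorm x = supnorm y.
Proof. by rewrite /supnorm => -[] [-> ->] //; rewrite maxC. Qed.

Lemma square_sym_sqnorm x y : square_sym x y -> sqnorm x = sqnorm y.
Proof.
rewrite /sqnorm -(real_normK (num_real (Re x))) -(real_normK (num_real (Im x))).
rewrite -(real_normK (num_real (Re y))) -(real_normK (num_real (Im y))).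
by move=> [] [-> ->] //; rewrite addrC.
Qed.

Lemma square_symV x y : square_sym x y -> square_sym x^-1 y^-1.
Proof.
move=> xy; have N := square_sym_sqnorm xy.
rewrite /square_sym !complexReV !complexImV N !normrM !normrN.
by case: xy => -[-> ->]; [left|right].
Qed.

(** Up to sign, x and y agree modulo 1. Two distinct points of the closed interval that agree modulo
    1 are its two ends, which have the same absolute value. *)
Lemma int_fold (x y m n : R) : m \is a Num.int -> n \is a Num.int ->
  `|x| <= 2^-1 -> `|y| <= 2^-1 -> `|x + m| = `|y + n| -> `|x| = `|y|.
Proof.
have aux (k u t : R) : k \is a Num.int -> `|u| <= 2^-1 -> `|t| <= 2^-1 ->
    u = t + k -> `|u| = `|t|.
  move=> ki; rewrite !ler_norml => u2 t2 utk.
  have [k1|k1] := ltP k 1; last first.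
    have -> : u = 2^-1 by lra.
    by have -> : t = - 2^-1; [lra|rewrite normrN].
  have [k2|k2] := ltP (- k) 1; last first.
    have -> : u = - 2^-1 by lra.
    by have -> : t = 2^-1; [lra|rewrite normrN].
  have := int_lt1_le0 ki k1; have := int_lt1_le0 (rpredNr ki) k2 => h1 h2.
  by rewrite utk (_ : k = 0) ?addr0 //; lra.
move=> mi ni x2 y2 /eqP; rewrite eqr_norm2 => /orP[] /eqP h.
  by apply: (aux (n - m)); rewrite ?rpredB //; lra.
rewrite -(normrN y); apply: (aux (- n - m)); rewrite ?rpredB ?rpredN ?normrN //; lra.
Qed.

Lemma square_sym_fold x y c d : gaussian_int c -> gaussian_int d ->
  supnorm x <= 2^-1 -> supnorm y <= 2^-1 ->
  square_sym (x + c) (y + d) -> square_sym x y.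
Proof.
move=> [rc ic] [rd id]; rewrite !supnorm_le => /andP[xr xi] /andP[yr yi].
rewrite /square_sym !complexReD !complexImD => -[] [h1 h2]; [left|right];
  split; by [apply: int_fold h1|apply: int_fold h2].
Qed.

(* The bound is preserved along the expansion of [z]; it keeps each remainder of [z]
   closer to the corresponding rational than the distance at which that rational
   could lie outside the unit square, so both words have the same digits up to
   the symmetries of the square. *)
Lemma close_convergent s a z w P Q : reduced s -> size a = size s ->
  expands a z -> gaussian_int P -> gaussian_int Q -> w * Q = P ->
  sqnorm Q = sqnorm (den s) -> square_sym w (cfrac s 0) ->
  Normc.normc (z - w) * (4 * sqnorm Q - 2) < 1 -> cfrac a 0 = w.
Proof.
elim: s a z w P Q => [|b s IH] [|d a] z w P Q //.
  move=> _ _ _ _ _ _ _ /square_sym_sqnorm; rewrite /= => h _.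
  apply/esym/eqP; rewrite -sqnorm_eq0 h; apply/eqP.
  by rewrite /sqnorm /= expr0n addr0.
move=> h [sza] [_ [z0 zd ez]] gP gQ wQ QE ws close.
have [bd hs rs] := h.
have r0 : cfrac (b :: s) 0 != 0.
  by rewrite invr_neq0 // digitD_neq0 // reduced_supnorm.
have w0 : w != 0 by rewrite -sqnorm_eq0 (square_sym_sqnorm ws) sqnorm_eq0.
have wN := supnorm_half_sqnorm (z := w); rewrite (square_sym_supnorm ws) in wN.
have {wN} := wN hs; rewrite -sqr_normc => wN.
have Q0 : Q != 0 by rewrite -sqnorm_eq0 QE sqnorm_eq0 (reduced_den_neq0 h).
have P0 : P != 0 by rewrite -wQ mulf_neq0.
have PE : sqnorm P = sqnorm (den s).
  rewrite -wQ sqnormM (square_sym_sqnorm ws) QE mulrC -sqnormM.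
  by rewrite (reduced_denM rs bd).
have [gd Fz1] := (nearestP _ _).1 zd.
set w1 := w^-1 - d; set z1 := z^-1 - d in ez Fz1.
have w1P : w1 * P = Q - d * P by rewrite /w1 -wQ; field.
(* Inversion divides the distance D by |z| |w|, and |P| = |w| |Q|. The summand -2 pays for the loss
   in |z| >= |w| - D: this requires |w| + 2 |w|^2 <= 2, which follows from |w|^2 <= 1/2. *)
have D1 : Normc.normc (z1 - w1) * (4 * sqnorm P - 2) < 1.
  have -> : z1 - w1 = (w - z) / (z * w) by rewrite /z1 /w1; field; rewrite z0 w0.
  rewrite Normc.normcM normcV1 Normc.normcM (normcBC w) -wQ sqnormM -sqr_normc.
  have : Normc.normc w - Normc.normc (z - w) <= Normc.normc z.
    by have := normcB_le w (w - z); rewrite subKr (normcBC w).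
  have zp : 0 < Normc.normc z by rewrite normc_gt0.
  have wp : 0 < Normc.normc w by rewrite normc_gt0.
  have N1 := gaussian_sqnorm_ge1 gP P0.
  rewrite -wQ sqnormM -sqr_normc in N1.
  have := normc_ge0 (z - w).
  move: (Normc.normc (z - w)) (Normc.normc z) (Normc.normc w) (sqnorm Q) wN close zp wp N1.
  move=> D Z W N wN close zp wp N1 D0 WDZ.
  rewrite mulrAC ltr_pdivrMr ?mulr_gt0 // mul1r.
  have W1 : W <= 3 / 4 by nra.
  have h1 : D * (4 * N - 2) * W ^+ 2 < W ^+ 2 by rewrite -[ltRHS]mul1r ltr_pM2r // exprn_gt0.
  have h2 : D * (W + 2 * W ^+ 2) <= D * 2 by apply: ler_wpM2l => //; nra.
  have h3 : W * W - W * D <= Z * W by rewrite -mulrBr mulrC ler_pM2r.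
  nra.
have N1 := gaussian_sqnorm_ge1 gP P0.
have gQ' := gaussianB gQ (gaussianM gd gP).
(* As |P|^2 >= 1, one has 2 |P|^2 <= 4 |P|^2 - 2, so [D1] is within the threshold of
   [supnorm_grid]. *)
have w1s : supnorm w1 <= 2^-1.
  apply: (supnorm_grid gQ' gP P0 w1P (fundamental_supnorm Fz1)).
  apply: le_lt_trans D1; rewrite mulrC; apply: ler_wpM2l; first exact: normc_ge0.
  by lra.
have : cfrac a 0 = w1.
  apply: (IH a z1 w1 _ _ rs sza ez gQ' gP w1P PE _ D1).
  apply: (square_sym_fold (c := d) (d := b)) => //; first by case: bd.
    exact: reduced_supnorm.
  rewrite /w1 subrK [_ + b]addrC -[b + _]invrK.
  exact: square_symV.
by rewrite /= => ->; rewrite /w1 addrC subrK invrK.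
Qed.

Lemma expands_close_convergent s a z : reduced s -> size a = size s ->
  expands a z -> Normc.normc (z - cfrac s 0) * (4 * sqnorm (den s)) <= 1 ->
  cfrac a 0 = cfrac s 0.
Proof.
move=> rs sz ez h; have [gQ gP] := gaussian_den rs.
apply: (close_convergent rs sz ez gP gQ _ erefl) => //; first exact: mulrC.
  by left.
have [->|zr] := eqVneq (Normc.normc (z - cfrac s 0)) 0; first by rewrite mul0r.
apply: lt_le_trans h; rewrite ltr_pM2l; first by lra.
by rewrite lt0r zr normc_ge0.
Qed.

(** Convergents are in lowest terms: one step of the Euclidean algorithm carries a Bezout relation
    from [s] to [b :: s]. *)
Lemma den_bezout s : reduced s -> exists c d, [/\ gaussian_int c, gaussian_int d
  & c * (den s * cfrac s 0) + d * den s = 1].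
Proof.
elim: s => [_|b s IH h].
  exists 0, 1; split; [exact: gaussian0|exact: gaussian1|].
  by rewrite /= mulr0 mul0r mulr1 add0r.
have [bd _ rs] := h; have [c [d [gc gd E]]] := IH rs.
exists (d - c * b), c; split=> //.
  by apply: gaussianB => //; apply: gaussianM => //; case: bd.
by rewrite (reduced_denM rs bd) -E /=; ring.
Qed.

Lemma den_dvd s a : reduced s -> reduced a -> cfrac s 0 = cfrac a 0 ->
  exists2 e, gaussian_int e & den s = e * den a.
Proof.
move=> rs ra sa; have [c [d [gc gd E]]] := den_bezout ra.
have [gs gsr] := gaussian_den rs.
exists (c * (den s * cfrac s 0) + d * den s).
  by apply: gaussianD; apply: gaussianM.
by rewrite -[LHS]mulr1 -E sa; ring.
Qed.

Lemma gaussian_unit_sqr e : gaussian_int e -> sqnorm e = 1 ->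
  e ^+ 2 = 1 \/ e ^+ 2 = -1.
Proof.
move=> [re ie] e1.
have : Re e ^+ 2 \is a Num.int by rewrite rpredX.
have := sqr_ge0 (Im e); have := sqr_ge0 (Re e); move: e1; rewrite /sqnorm => e1 r0 i0 ri.
have [r1|r1] := ltP 0 (Re e ^+ 2).
  have := int_gt0_ge1 ri r1 => r2.
  have i1 : Im e = 0 by apply/eqP; rewrite -sqrf_eq0; apply/eqP; lra.
  left; apply: complex_ext; rewrite expr2 !ReImE i1 /=; [|by ring].
  by rewrite -expr2; lra.
have i1 : Re e = 0 by apply/eqP; rewrite -sqrf_eq0; apply/eqP; lra.
right; apply: complex_ext; rewrite expr2 !ReImE i1 /=; [|by ring].
by rewrite -expr2; lra.
Qed.

(** In lowest terms the denominator is determined up to a unit of the Gaussian integers, and the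
    square of a unit is 1 or -1. *)
Lemma den_sqr s a : reduced s -> reduced a -> cfrac s 0 = cfrac a 0 ->
  exists2 e : R[i], e = 1 \/ e = -1 & den s ^+ 2 = e * den a ^+ 2.
Proof.
move=> rs ra sa.
have [e ge E] := den_dvd rs ra sa.
have [f gf F] := den_dvd ra rs (esym sa).
have s0 := reduced_den_neq0 rs.
have ef : e * f = 1 by apply: (mulIf s0); rewrite -mulrA -F -E mul1r.
have e0 : e != 0 by apply: contra_eq_neq ef => ->; rewrite mul0r eq_sym oner_neq0.
have f0 : f != 0 by apply: contra_eq_neq ef => ->; rewrite mulr0 eq_sym oner_neq0.
have e1 : sqnorm e = 1.
  have := congr1 (@sqnorm R) ef; rewrite sqnormM sqnorm1.
  have := gaussian_sqnorm_ge1 ge e0; have := gaussian_sqnorm_ge1 gf f0; nra.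
exists (e ^+ 2); first exact: gaussian_unit_sqr.
by rewrite E exprMn.
Qed.

End Uniqueness.

(** * The shape of the set of remainders of a cylinder *)

Section Sectors.
Variable R : realType.
Implicit Types (z w x y c d e k v : R[i]) (s : seq R[i]).
Local Notation Re := complex.Re.
Local Notation Im := complex.Im.

(* The Gaussian integers at one chess king's move from 0. *)
Definition king c : Prop := [/\ gaussian_int c, c != 0 & supnorm c <= 1].

Lemma sqnormB x y : sqnorm (x - y) = sqnorm x - 2 * Re (x * (conjc y)) + sqnorm y.
Proof. by rewrite /sqnorm !ReImE; ring. Qed.

Lemma sqnormVB v c : v != 0 ->
  sqnorm (v^-1 - c) * sqnorm v = 1 - 2 * Re (c * v) + sqnorm c * sqnorm v.
Proof.
move=> v0; rewrite -sqnormM mulrBl mulVf // sqnormB sqnorm1 sqnormM.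
by rewrite !ReImE /=; ring.
Qed.

Lemma int_norm_le1 (m : R) : m \is a Num.int -> `|m| <= 1 ->
  [\/ m = -1, m = 0 | m = 1].
Proof.
move=> mi; rewrite ler_norml => m1.
have [h|h] := ltP m 1; last by apply: Or33; lra.
have [h'|h'] := ltP (- m) 1; last by apply: Or31; lra.
by have := int_lt1_le0 mi h; have := int_lt1_le0 (rpredNr mi) h' => *; apply: Or32; lra.
Qed.

Lemma gaussian_unitP e : gaussian_int e -> sqnorm e = 1 ->
  (`|Re e| = 1 /\ Im e = 0) \/ (Re e = 0 /\ `|Im e| = 1).
Proof.
move=> [re ie]; rewrite /sqnorm => e1.
have h1 : `|Re e| <= 1 by rewrite ler_norml; apply/andP; split; nra.
have h2 : `|Im e| <= 1 by rewrite ler_norml; apply/andP; split; nra.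
move: e1; case: (int_norm_le1 re h1) => ->; case: (int_norm_le1 ie h2) => ->;
  rewrite ?normrN ?normr1 => e1; first [by left | by right | by exfalso; lra].
Qed.

Lemma king_sqnorm c : king c -> sqnorm c = 1 \/ sqnorm c = 2.
Proof.
move=> [[rc ic] c0]; rewrite supnorm_le => /andP[h1 h2].
move: c0; rewrite -sqnorm_eq0 /sqnorm.
case: (int_norm_le1 rc h1) => ->; case: (int_norm_le1 ic h2) => ->;
  rewrite ?sqrrN ?expr1n ?expr0n /= ?addr0 ?add0r ?eqxx // => _; by [left|right].
Qed.

Lemma unit_king c : gaussian_int c -> sqnorm c = 1 -> king c.
Proof.
move=> gc c1; split => //; first by rewrite -sqnorm_eq0 c1 oner_neq0.
by rewrite supnorm_le; case: (gaussian_unitP gc c1) => -[-> ->]; rewrite normr0 lexx ler01.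
Qed.

Lemma kingJ c : king c -> king (conjc c).
Proof.
move=> [gc c0 c1]; split; [exact: gaussianJ|by rewrite conjc_eq0|].
by move: c1; rewrite !supnorm_le complexReJ complexImJ normrN.
Qed.

Lemma unit_Re_le v e : gaussian_int e -> sqnorm e = 1 -> `|Re (e * v)| <= supnorm v.
Proof.
move=> ge e1; rewrite /supnorm le_max complexReM.
by case: (gaussian_unitP ge e1) => -[h1 h2]; rewrite ?h2 ?h1 mul0r ?subr0 ?sub0r
  ?normrN normrM ?h1 ?h2 mul1r lexx ?orbT.
Qed.

Lemma supnormV_half v : v != 0 ->
  supnorm v^-1 < 2^-1 <->
  (forall e, gaussian_int e -> sqnorm e = 1 -> 1 < sqnorm (v - e)).
Proof.
move=> v0; have Nv : 0 < sqnorm v by rewrite sqnorm_gt0.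
have supE : supnorm v^-1 = supnorm v / sqnorm v.
  rewrite /supnorm complexReV complexImV !normrM normrN normfV (gtr0_norm Nv).
  by rewrite -maxr_pMl // invr_ge0 ltW.
rewrite supE ltr_pdivrMr //; split=> [h e ge e1|h].
  rewrite sqnormB e1.
  have e1' : sqnorm (conjc e) = 1 by rewrite sqnormJ.
  have := unit_Re_le v (gaussianJ ge) e1'; rewrite mulrC ler_norml; lra.
have one (a b : R) : a \is a Num.int -> b \is a Num.int -> a ^+ 2 + b ^+ 2 = 1 ->
    2 * (Re v * a + Im v * b) < sqnorm v.
  move=> ai bi ab; have := h (a +i* b) (conj ai bi) ab.
  by rewrite sqnormB [sqnorm (_ +i* _)]ab !ReImE /= mulrN opprK; lra.
have n1 : (-1 : R) \is a Num.int by rewrite rpredN rpred1.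
have h1 := one 1 0 (rpred1 _) (rpred0 _); have h2 := one (-1) 0 n1 (rpred0 _).
have h3 := one 0 1 (rpred0 _) (rpred1 _); have h4 := one 0 (-1) (rpred0 _) n1.
move: h1 h2 h3 h4; rewrite ?sqrrN ?expr1n ?expr0n /= ?addr0 ?add0r.
move=> /(_ erefl) h1 /(_ erefl) h2 /(_ erefl) h3 /(_ erefl) h4.
by rewrite /supnorm gt_max !ltr_norml; lra.
Qed.

(** A nonzero Gaussian integer beyond a king's move has a coordinate of modulus at least 2, so it is
    more than 3/2 away from the open square. *)
Lemma far_lattice w k : gaussian_int k -> k != 0 -> supnorm w < 2^-1 ->
  (king k -> 1 < sqnorm (w - k)) -> 1 < sqnorm (w - k).
Proof.
move=> gk k0 w2 h; have [/(And3 gk k0)//|k1] := lerP (supnorm k) 1.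
have {k1} : 1 < `|Re k| \/ 1 < `|Im k|.
  by move: k1; rewrite /supnorm lt_max => /orP.
have [rk ik] := gk; move: w2; rewrite /supnorm gt_max => /andP[rw iw].
have two (m x : R) : m \is a Num.int -> 1 < `|m| -> `|x| < 2^-1 -> 1 < (x - m) ^+ 2.
  move=> mi m1; rewrite ltr_norml => xx; move: m1; rewrite ltr_normr => /orP[] m1.
    have : 1 <= m - 1 by rewrite int_gt0_ge1 ?rpredB ?rpred1 // subr_gt0.
    by move=> m2; nra.
  have : 1 <= - m - 1 by rewrite int_gt0_ge1 ?rpredB ?rpredN ?rpred1 // subr_gt0.
  by move=> m2; nra.
rewrite /sqnorm !ReImE => -[] k1.
  by have := two _ _ rk k1 rw; have := sqr_ge0 (Im w - Im k); lra.
by have := two _ _ ik k1 iw; have := sqr_ge0 (Re w - Re k); lra.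
Qed.

Lemma open_fundamental w : supnorm w < 2^-1 -> fundamental_domain w.
Proof. by rewrite /supnorm gt_max !ltr_norml => h; apply/fundamentalP; lra. Qed.

Lemma expands_cfrac_rcons s d w : digit d ->
  expands (rcons s d) (cfrac (rcons s d) w) <->
  [/\ expands s (cfrac s (d + w)^-1), d + w != 0 & fundamental_domain w].
Proof.
move=> dd; rewrite cfrac_rcons; split=> [/expands_rcons[h]|[h h0 Fw]].
  rewrite remainder_cfrac // invrK invr_eq0 => h0 _.
  by rewrite addrAC subrr add0r.
apply/expands_rcons; rewrite remainder_cfrac // invrK invr_eq0.
by rewrite addrAC subrr add0r; split=> //; case: dd.
Qed.

(* Regularity of [s], in a form inherited by prefixes. *)
Definition fat s : Prop := forall j, exists2 w, supnorm w < 2^-1 &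
  expands (take j s) (cfrac (take j s) w).

(** Up to boundary points, the remainders fill the unit square minus the unit discs around the
    elements of [K]. Appending a digit inverts this region and cuts out the square around that
    digit. *)
Lemma remainder_shape s : {in s, forall d, digit d} -> fat s ->
  exists K : set R[i], [/\ forall c, K c -> king c,
    forall c, K c -> ~ K (- c),
    forall w, expands s (cfrac s w) -> forall c, K c -> 1 <= sqnorm (w - c) &
    forall w, supnorm w < 2^-1 -> (forall c, K c -> 1 < sqnorm (w - c)) ->
      expands s (cfrac s w)].
Proof.
elim/last_ind: s => [_ _|s d IH sd fs].
  exists set0; split=> [c []|c []|w _ c []|w w2 _] /=.
  by split=> //; exact: open_fundamental.
have dd : digit d by apply: sd; rewrite mem_rcons inE eqxx.
have gd : gaussian_int d by case: dd.
have [||K [K8 Kopp Kout Kin]] := IH.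
- by move=> c cs; apply: sd; rewrite mem_rcons inE cs orbT.
- move=> j; have [js|js] := leqP j (size s).
    by have [w w2] := fs j; rewrite -cats1 takel_cat //; exists w.
  have [w w2] := fs (size s); rewrite -cats1 take_size_cat // take_oversize ?(ltnW js) //.
  by exists w.
have [w0 w02] := fs (size (rcons s d)); rewrite take_size => /expands_cfrac_rcons.
move=> /(_ dd)[h0 d0 _].
(* Inversion maps the sides of the square to the unit circles around the units, the
   unit circle around a diagonal neighbour to the one around its conjugate, and the
   unit circle around a unit [c] to the line [Re (c * v) = 1 / 2], which does not
   cross the interior of the square around [d]. *)
pose E c := king c /\ (sqnorm c = 1 \/ (K (conjc c) /\ sqnorm c = 2)).
exists [set k | king k /\ E (k + d)]; split.
- by move=> c [].
(* If k and -k both belonged to the set, then |Re k| + |Re d| <= 1 and likewise for imaginary parts,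
   so |k|^2 + |d|^2 <= 2, against |d|^2 >= 2 and k != 0. *)
- move=> k [[gk k0 _] [[_ _ h1] _]] [_ [[_ _ h2] _]].
  have := digit_sqnorm dd; move: k0; rewrite -sqnorm_gt0 /sqnorm.
  move: h1 h2; rewrite !supnorm_le !ReImE !ler_norml.
  move: (Re k) (Im k) (Re d) (Im d) => a b m n.
  move=> /andP[/andP[h1 h2] /andP[h3 h4]] /andP[/andP[h5 h6] /andP[h7 h8]] ab mn.
  have m1 : m ^+ 2 <= 1 - a ^+ 2 by nra.
  have n1 : n ^+ 2 <= 1 - b ^+ 2 by nra.
  by lra.
- move=> w /expands_cfrac_rcons-/(_ dd)[h dw _] k [dw8 [_ Ek]].
  have -> : w - k = (d + w) - (k + d) by ring.
  move: Ek; set e := k + d; set v := d + w in h dw *.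
  have Nv : 0 < sqnorm v by rewrite sqnorm_gt0.
  case=> [e1|[Ke e2]].
    have ge : gaussian_int e by apply: gaussianD => //; case: dw8.
    have := unit_Re_le v^-1 ge e1; have := fundamental_supnorm (expands_remainder h).
    rewrite remainder_cfrac // => h1 /ler_normlW/le_trans/(_ h1).
    have -> : Re (e * v^-1) = Re (v * (conjc e)) / sqnorm v.
      by rewrite /v !ReImE complexReV complexImV !ReImE; ring.
    by rewrite ler_pdivrMr // sqnormB e1; lra.
  have := sqnormVB (conjc e) dw; have := Kout _ h _ Ke.
  rewrite sqnormJ e2 (sqnormB v e) e2 [(conjc e) * v]mulrC => h1 h2.
  have : 1 * sqnorm v <= sqnorm (v^-1 - (conjc e)) * sqnorm v by rewrite ler_pM2r.
  by rewrite h2; lra.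
move=> w w2 h; apply/expands_cfrac_rcons => //.
have dw : d + w != 0 by rewrite digitD_neq0 // ltW.
split=> //; last exact: open_fundamental.
have inE k : gaussian_int k -> k != d -> E k -> 1 < sqnorm (d + w - k).
  move=> gk kd Ek; have -> : d + w - k = w - (k - d) by ring.
  apply: far_lattice => //; [exact: gaussianB|by rewrite subr_eq0|].
  by move=> kk; apply: h; split=> //; rewrite subrK.
apply: Kin.
  apply/supnormV_half => // e ge e1; apply: inE => //.
    apply: contra_eq_neq e1 => ->; have := digit_sqnorm dd.
    by apply: contraTneq => ->; rewrite -ltNge; lra.
  by split; [exact: unit_king|left].
move=> c Kc; have Nv : 0 < sqnorm (d + w) by rewrite sqnorm_gt0.
have Nv0 : 0 < sqnorm (d + w0) by rewrite sqnorm_gt0.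
rewrite -(ltr_pM2r Nv) sqnormVB // mul1r.
have := sqnormVB c d0; have := Kout _ h0 _ Kc.
rewrite -(ler_pM2r Nv0) mul1r => h1 h2; rewrite h2 {h2} in h1.
have [c1|c2] := king_sqnorm (K8 _ Kc); have [gc c0 _] := K8 _ Kc.
  rewrite c1 mul1r in h1; rewrite c1 mul1r.
  have := unit_Re_le w gc c1; have := unit_Re_le w0 gc c1.
  move: h1; rewrite !(mulrDr c) !(complexReD (c * d)) => h1.
  rewrite !ler_norml => h2 h3.
  (* The point [w0] given by fatness puts this integer below 1; being at most 0, it keeps the whole
     open square around [d] in the half-plane. *)
  have : Re (c * d) <= 0 by apply: int_lt1_le0; [by case: (gaussianM gc gd)|lra].
  by lra.
have : 1 < sqnorm (d + w - (conjc c)).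
  apply: inE.
  - exact: gaussianJ.
  (* If [d] were conj(c), then d + w0 would be in the excluded disc, since |w0|^2 <= 1/2. *)
  - apply: contraTneq h1 => cd; rewrite -cd c2 -ltNge.
    have := supnorm_half_sqnorm (ltW w02).
    have -> : sqnorm w0 = sqnorm ((conjc c) + w0 - (conjc c)) by congr sqnorm; ring.
    by rewrite sqnormB conjcK sqnormJ c2 [_ * c]mulrC; lra.
  - by split; [exact/kingJ/K8|right; rewrite conjcK sqnormJ].
by rewrite sqnormB conjcK sqnormJ c2 [_ * c]mulrC; lra.
Qed.

End Sectors.

(** * Sectors near infinity, continuity, and interior points of cylinders *)

Section Topology.
Variable R : realType.
Implicit Types (z w x y c d e k v : R[i]) (s : seq R[i]).
Local Notation Re := complex.Re.
Local Notation Im := complex.Im.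

(* Since [U] contains no opposite units, the points [v] form, outside a disc, a plane,
   a half-plane or a quadrant. *)
Lemma remainder_sector s : {in s, forall d, digit d} -> fat s ->
  exists U : set R[i], [/\ forall c, U c -> gaussian_int c /\ sqnorm c = 1,
    forall c, U c -> ~ U (- c),
    forall v, v != 0 -> expands s (cfrac s v^-1) -> forall c, U c -> 2 * Re (c * v) <= 1 &
    forall v, 3 <= Normc.normc v -> (forall c, U c -> 2 * Re (c * v) < 1) ->
      expands s (cfrac s v^-1)].
Proof.
move=> sd /(remainder_shape sd)[K [K8 Kopp Kout Kin]].
exists [set c | K c /\ sqnorm c = 1]; split.
- by move=> c [/K8[]].
- by move=> c [Kc _] [/(Kopp _ Kc)].
- move=> v v0 h c [Kc c1]; have Nv : 0 < sqnorm v by rewrite sqnorm_gt0.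
  have := Kout _ h _ Kc; rewrite -(ler_pM2r Nv) sqnormVB // c1; lra.
move=> v v3 h.
have v0 : v != 0 by rewrite -normc_gt0; lra.
have Nv : 0 < sqnorm v by rewrite sqnorm_gt0.
apply: Kin => [|c Kc].
  by apply: le_lt_trans (supnorm_le_normc _) _; rewrite normcV1 invf_plt ?posrE ?invrK; lra.
rewrite -(ltr_pM2r Nv) sqnormVB // mul1r.
have [gc c0 _] := K8 _ Kc; have [c1|c2] := king_sqnorm (K8 _ Kc).
  by have := h c (conj Kc c1); rewrite c1; lra.
(* A diagonal neighbour has modulus sqrt 2 < 3/2, so its unit disc is out of reach once |v| >= 3. *)
have : 1 < sqnorm (v - conjc c).
  have := normcB_le v (conjc c); rewrite -[sqnorm (_ - _)]sqr_normc.
  have := normc_ge0 (conjc c); have : Normc.normc (conjc c) ^+ 2 = 2 by rewrite sqr_normc sqnormJ.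
  move: (Normc.normc _) (Normc.normc _) (Normc.normc _) v3 => p q t *.
  have : q < 3 / 2 by nra.
  by nra.
by rewrite sqnormB conjcK sqnormJ c2 [_ * c]mulrC; lra.
Qed.

Lemma ball_normc (x y : R[i]^o) (r : R) : ball x r%:C y = (Normc.normc (x - y) < r) :> Prop.
Proof. by rewrite -ball_normE /ball_ /= normc_def ltcR normc_sqnorm. Qed.

Lemma nbhs_normc (x : R[i]^o) (A : set R[i]^o) : nbhs x A <->
  exists2 r : R, 0 < r & forall y, Normc.normc (x - y) < r -> A y.
Proof.
split=> [/nbhs_ballP[e /= e0 h]|[r r0 h]].
  have eE : e = (complex.Re e)%:C by rewrite RRe_real // gtr0_real.
  exists (Re e); first by rewrite -ltcR -eE.
  by move=> y xy; apply: h; rewrite eE ball_normc.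
apply/nbhs_ballP; exists r%:C; first by rewrite /= ltcR.
by move=> y; rewrite ball_normc; exact: h.
Qed.

Lemma expands_take s j z : expands s z -> expands (take j s) z.
Proof.
elim: s j z => [|d s IH] [|j] z //=; first by case.
by move=> [Fz [z0 zd h]]; split=> //; split=> //; exact: IH.
Qed.

Lemma cfrac_continuous s w (eps : R) : expands s (cfrac s w) -> 0 < eps ->
  exists2 delta : R, 0 < delta & forall x, Normc.normc (w - x) < delta ->
    Normc.normc (cfrac s w - cfrac s x) < eps.
Proof.
elim: s eps => [eps _ eps0|d s IH eps [_ [h0 _ h]] eps0]; first by exists eps.
have {h} es : expands s (cfrac s w) by move: h; rewrite /= invrK addrC addKr.
have u0 : d + cfrac s w != 0 by move: h0; rewrite /= invr_eq0.
have U0 : 0 < Normc.normc (d + cfrac s w) by rewrite normc_gt0.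
set u := d + _ in u0 U0; set U := Normc.normc u in U0.
(* The first bound keeps |t| above U / 2; the second then makes |u - t| / (|u| |t|) less than
   [eps]. *)
have [|delta delta0 hd] := IH (Num.min (U / 2) (eps * U ^+ 2 / 2)) es.
  by rewrite lt_min divr_gt0 // divr_gt0 // mulr_gt0 // exprn_gt0.
exists delta => // x /hd; rewrite lt_min => /andP[h1 h2].
rewrite -[cfrac (d :: s) w]/(u^-1) /=; set t := d + cfrac s x.
have tu : cfrac s w - cfrac s x = u - t by rewrite /u /t; ring.
rewrite tu in h1 h2.
have T : U / 2 < Normc.normc t by have := normcB_le u (u - t); rewrite subKr -/U; lra.
have t0 : t != 0 by rewrite -normc_gt0; lra.
have -> : u^-1 - t^-1 = (t - u) / (u * t) by field; rewrite u0 t0.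
rewrite Normc.normcM normcV1 Normc.normcM -/U normcBC ltr_pdivrMr.
2: by rewrite mulr_gt0 //; lra.
apply: (lt_le_trans h2); rewrite -mulrA ler_pM2l //; nra.
Qed.

(** By continuity of [cfrac], a whole neighbourhood of the remainder of an interior point consists
    of remainders, hence lies in the fundamental domain. *)
Lemma regular_fat n (a : n.-tuple R[i]) : regular_word a -> fat a.
Proof.
move=> [da [z0 /nbhs_normc[r r0 h]]] j; set t := take j a.
have et z : Normc.normc (z0 - z) < r -> expands t z.
  by move=> /h /(cylinder_expands _ da); exact: expands_take.
set w0 : R[i]^o := remainder t z0.
have e0 : expands t z0.
  apply: et; rewrite subrr.
  by have -> : Normc.normc (0 : R[i]) = 0 := Normc.normc0 R.
have w0E : cfrac t w0 = z0 := cfrac_remainder e0.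
have ew0 : expands t (cfrac t w0) by rewrite w0E.
have /nbhs_normc[q q0 hq] : nbhs w0 [set w | expands t (cfrac t w)].
  have [delta delta0 hd] := cfrac_continuous ew0 r0.
  by apply/nbhs_normc; exists delta => // y /hd; rewrite w0E; exact: et.
(* The domain is half-open. That it contains the point moved diagonally by q / 3 makes the lower
   inequalities strict for the point moved by q / 4; the upper ones are strict already. *)
have hF p : 0 < p -> p < q / 2 ->
    let w := w0 - (p +i* p) in expands t (cfrac t w) /\ fundamental_domain w.
  move=> p0 pq w; have ew : expands t (cfrac t w).
    apply: hq; rewrite subKr; apply: le_lt_trans (normc_le_supnorm _) _.
    by rewrite /supnorm /= maxxx gtr0_norm //; lra.
  by split=> //; have := expands_remainder ew; rewrite remainder_cfrac.
have Fw0 : fundamental_domain w0 := expands_remainder e0.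
have [_ /fundamentalP h1] := hF (q / 3) ltac:(lra) ltac:(lra).
have [h2 /fundamentalP h3] := hF (q / 4) ltac:(lra) ltac:(lra).
exists (w0 - (q / 4 +i* (q / 4))) => //.
move/fundamentalP: Fw0 h1 h3; rewrite /supnorm !ReImE /= gt_max !ltr_norml; lra.
Qed.

End Topology.

(** * Estimates in the coordinate y, and points shared by cylinders *)

Section Counting.
Variable R : realType.
Implicit Types (z w x y c d e k v : R[i]) (s a b : seq R[i]).
Local Notation Re := complex.Re.
Local Notation Im := complex.Im.

Lemma card_le2 (T : Type) (A : set T) :
  (forall x y z : T, A x -> A y -> A z -> [\/ x = y, x = z | y = z]) -> (A #<= `I_2)%card.
Proof.
move=> A2; have [->|/set0P[x Ax]] := eqVneq A set0; first exact: card_ge0.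
have [[y [Ay xy]]|nA] := pselect (exists y : T, A y /\ x <> y).
  have sub : A `<=` (fun n => if n is 0%N then x else y) @` `I_2.
    by move=> z Az; case: (A2 _ _ _ Ax Ay Az) => [//|<-|<-]; [exists 0%N|exists 1%N].
  exact: card_le_trans (subset_card_le sub) (card_image_le _ _).
have sub : A `<=` (fun _ => x) @` `I_2.
  by move=> z Az; exists 0%N => //; apply: contrapT => xz; apply: nA; exists z.
exact: card_le_trans (subset_card_le sub) (card_image_le _ _).
Qed.

(* [y - shift s] is the inverse of the remainder of [x]; the first clause is then the
   conclusion of [cfrac_far]. *)
Definition is_coord s y x : Prop :=
  [/\ x = cfrac s 0 + (-1) ^+ size s / (den s ^+ 2 * y), expands s x &
      x = cfrac s (y - shift s)^-1].

(** The inverse remainder is within 1/2 of [d] in supremum norm, and adding [shift a] costs less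
    than 2; the modulus is at most 3/2 times the supremum norm. *)
Lemma cylinder_coord n (a : n.-tuple R[i]) d x (l u : R) :
  regular_word a -> digit d -> cylinder (rcons_tuple a d) x ->
  11 < l -> l <= supnorm d <= u ->
  reduced a /\ exists y, [/\ is_coord a y x, l - 5 / 2 <= supnorm y &
    Normc.normc y <= 3 / 2 * u + 3].
Proof.
move=> [da _] dd + l11 ld.
have dad j : digit (tnth (rcons_tuple a d) j).
  have : tnth (rcons_tuple a d) j \in rcons a d by rewrite mem_tnth.
  by rewrite mem_rcons inE => /orP[/eqP -> //|/tnthP[i ->]].
move=> /(cylinder_expands _ dad)/= /expands_rcons[ex r0 _ Fd].
set v := (remainder a x)^-1 in Fd.
have xE : x = cfrac a v^-1 by rewrite invrK cfrac_remainder.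
have vd := fundamental_supnorm Fd.
have v1 : l - 1 / 2 <= supnorm v.
  by have := supnormD v (- (v - d)); rewrite subKr supnormN; lra.
have v2 : supnorm v <= u + 1 / 2.
  by have := supnormD (v - d) d; rewrite subrK; lra.
have v3 := supnorm_le_normc v; have v4 := normc_le_supnorm v.
have ra : reduced a.
  apply: (expands_reduced (v := v)); rewrite -?xE //; last by lra.
  by move=> c /tnthP[j ->].
split=> //; have sh := shift_lt2 ra; exists (v + shift a); split.
- by split; rewrite ?addrK // -cfrac_far // -?xE //; lra.
- have := supnormD (v + shift a) (- shift a); rewrite addrK supnormN.
  by have := supnorm_le_normc (shift a); lra.
- by have := normcD v (shift a); lra.
Qed.

Lemma coord_dist s y x (m : R) : reduced s -> is_coord s y x -> 0 < m ->
  m <= Normc.normc y ->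
  Normc.normc (x - cfrac s 0) <= (m * sqnorm (den s))^-1.
Proof.
move=> rs [-> _ _] m0 my.
have q0 : 0 < sqnorm (den s) by rewrite sqnorm_gt0 reduced_den_neq0.
rewrite addrC addKr Normc.normcM normc_sign mul1r normcV1 !Normc.normcM.
rewrite -expr2 sqr_normc lef_pV2 ?posrE ?mulr_gt0 //; last by lra.
by rewrite mulrC ler_pM2l.
Qed.

(** Here 17/2 = 11 - 5/2. If q is the smaller denominator, the point of the other word is within
    4/(17 |q|^2) of the convergent with denominator q, and 4/17 < 1/4 as [expands_close_convergent]
    demands. *)
Lemma same_center a b x x' y y' : reduced a -> reduced b -> size a = size b ->
  is_coord a y x -> is_coord b y' x' -> 17 / 2 <= Normc.normc y ->
  17 / 2 <= Normc.normc y' ->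
  Normc.normc (x - x') <= (17 / 2 * sqnorm (den a))^-1 ->
  cfrac b 0 = cfrac a 0.
Proof.
move=> ra rb sz cx cx' yl yl' xx'.
have qa : 0 < sqnorm (den a) by rewrite sqnorm_gt0 reduced_den_neq0.
have qb : 0 < sqnorm (den b) by rewrite sqnorm_gt0 reduced_den_neq0.
have m0 : 0 < 17 / 2 :> R by lra.
have := coord_dist ra cx m0 yl; have := coord_dist rb cx' m0 yl'.
have aux (q p t1 t2 : R) : 0 < q -> q <= p -> t1 <= (17 / 2 * p)^-1 ->
    t2 <= (17 / 2 * q)^-1 -> (t1 + t2) * (4 * q) <= 1.
  move=> q0 qp; rewrite !invfM => h1 h2.
  have : p^-1 <= q^-1 by rewrite lef_pV2 ?posrE //; lra.
  move=> pq; have : (t1 + t2) <= 4 / 17 * q^-1 by lra.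
  move=> h3; have : (t1 + t2) * q <= 4 / 17 by rewrite -ler_pdivlMr.
  by lra.
have [_ ex _] := cx; have [_ ex' _] := cx'.
have [ab|ab] := leP (sqnorm (den b)) (sqnorm (den a)) => h1 h2.
  apply/esym/(expands_close_convergent rb sz ex).
  apply: le_trans (aux _ _ _ _ qb ab xx' h1); apply: ler_wpM2r; first by lra.
  by apply: le_trans (normcD _ _); rewrite addrA subrK.
apply/(expands_close_convergent ra (esym sz) ex').
rewrite normcBC in xx'; apply: le_trans (aux _ _ _ _ qa (lexx _) xx' h2).
apply: ler_wpM2r; first by lra.
by apply: le_trans (normcD _ _); rewrite addrA subrK.
Qed.

(** The inequality is closed, so it passes from the cylinders to their closures. *)
Lemma annular_union_dist n (a : n.-tuple R[i]) (l u : R) (z : R[i]^o) :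
  regular_word a -> 11 < l -> annular_union a l u z ->
  Normc.normc (z - cfrac a 0) <= ((l - 5 / 2) * sqnorm (den a))^-1.
Proof.
move=> rega l11 [d [dd ld regd] zc].
rewrite leNgt; apply/negP => h.
have [x [cx]] : cylinder (rcons_tuple a d) `&` [set x : R[i]^o | Normc.normc (z - x) <
    Normc.normc (z - cfrac a 0) - ((l - 5 / 2) * sqnorm (den a))^-1] !=set0.
  by apply: zc; apply/nbhs_normc; eexists; last (move=> y; exact); rewrite subr_gt0.
have [ra [y [cy yl _]]] := cylinder_coord rega dd cx l11 ld.
have := coord_dist ra cy (_ : 0 < l - 5 / 2) (le_trans yl (supnorm_le_normc _)).
move=> /(_ ltac:(lra)) /=.
have := normcD (z - x) (x - cfrac a 0); rewrite addrA subrK; lra.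
Qed.

Lemma diameter_annular_union n (a : n.-tuple R[i]) (l u : R) (z : R[i]^o) :
  regular_word a -> 11 < l -> annular_union a l u z ->
  diameter (annular_union a l u) <= 2 / ((l - 5 / 2) * sqnorm (den a)).
Proof.
move=> rega l11 zS; apply: ge_sup.
  by exists (Normc.normc (z - z)); exists z => //; exists z.
move=> _ [x xS [y yS <-]].
have := annular_union_dist rega l11 xS; have := annular_union_dist rega l11 yS.
have := normcD (x - cfrac a 0) (cfrac a 0 - y); rewrite addrA subrK (normcBC (cfrac a 0)).
lra.
Qed.

Lemma annular_union_approx n (a : n.-tuple R[i]) (l u r : R) (z x : R[i]^o) :
  regular_word a -> 11 < l -> annular_union a l u x -> Normc.normc (z - x) < r ->
  reduced a /\ exists x' y, [/\ is_coord a y x', Normc.normc (z - x') < r,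
    l - 5 / 2 <= supnorm y & Normc.normc y <= 3 / 2 * u + 3].
Proof.
move=> rega l11 [d [dd ld regd] xc] zx.
have [x' [cx' x'z]] : cylinder (rcons_tuple a d) `&`
    [set x' : R[i]^o | Normc.normc (z - x') < r] !=set0.
  apply: xc; apply/nbhs_normc; exists (r - Normc.normc (z - x)).
    by rewrite subr_gt0.
  move=> y /= xy; have := normcD (z - x) (x - y); rewrite addrA subrK; lra.
have [ra [y [cy y1 y2]]] := cylinder_coord rega dd cx' l11 ld.
by split=> //; exists x', y.
Qed.

(** Multiplication by the unit turns a dominant coordinate of [y] onto the positive real axis; [c]
    thus names the axis direction in which [y] is far out. *)
Lemma supnorm_direction y : exists c, [/\ gaussian_int c, sqnorm c = 1 &
  Re (c * y) = supnorm y].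
Proof.
have n1 : (-1 : R) \is a Num.int by rewrite rpredN rpred1.
have i1 : (1 : R) \is a Num.int by rewrite rpred1.
have i0 : (0 : R) \is a Num.int by rewrite rpred0.
rewrite /supnorm; case: leP => _; [have [h|h] := leP 0 (Im y)|have [h|h] := leP 0 (Re y)].
- exists (0 +i* -1); split=> //; first by rewrite /sqnorm /= sqrrN expr0n expr1n add0r.
  by rewrite !ReImE /= ger0_norm //; ring.
- exists (0 +i* 1); split=> //; first by rewrite /sqnorm /= expr0n expr1n add0r.
  by rewrite !ReImE /= ltr0_norm //; ring.
- exists (1 +i* 0); split=> //; first by rewrite /sqnorm /= expr0n expr1n addr0.
  by rewrite !ReImE /= ger0_norm //; ring.
- exists (-1 +i* 0); split=> //; first by rewrite /sqnorm /= sqrrN expr0n expr1n addr0.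
  by rewrite !ReImE /= ltr0_norm //; ring.
Qed.

Lemma gaussian_normc1 e : sqnorm e = 1 -> Normc.normc e = 1.
Proof. by rewrite normc_sqnorm => ->; rewrite sqrtr1. Qed.

(* The conclusion only depends on [b] through one bit [t], so among three words with
   the same convergent two share a point; 10 is any number large enough to dominate
   [shift b]. *)
Lemma sector_diagonal b c x y (Q : R[i]) : {in b, forall d, digit d} -> fat b ->
  reduced b -> gaussian_int c -> sqnorm c = 1 -> is_coord b y x ->
  (exists2 e : R[i], e = 1 \/ e = -1 &
     den b ^+ 2 = e * Q /\ 6 <= Re (c * (e * y))) -> Q != 0 ->
  exists t : bool, expands b (cfrac b 0 +
    (-1) ^+ size b / (Q * (10 * c^-1 * (1 +i* (-1) ^+ t)))).
Proof.
move=> sb fb rb gc c1 [xE ex xv] [e e1 [QE ey]] Q0.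
have ee : e * e = 1 by case: e1 => ->; rewrite ?mulrNN mulr1.
have Ne : Normc.normc e = 1 by case: e1 => ->; rewrite ?normc_opp; exact: Normc.normc1.
have Nc := gaussian_normc1 c1.
have c0 : c != 0 by rewrite -sqnorm_eq0 c1 oner_neq0.
have gcV : gaussian_int c^-1.
  by have [? ?] := gc; split; rewrite ?complexReV ?complexImV c1 divr1 ?rpredN.
have ge : gaussian_int e by case: e1 => ->; [|apply: gaussianN]; exact: gaussian1.
have [U [U1 Uopp Uout Uin]] := remainder_sector sb fb.
have sh := shift_lt2 rb.
have bound k (w : R[i]) : Normc.normc k = 1 -> - Normc.normc w <= Re (k * w) <= Normc.normc w.
  by move=> k1; have := Re_le_normc (k * w); rewrite Normc.normcM k1 mul1r ler_norml.
have Nec : Normc.normc (e * c) = 1 by rewrite Normc.normcM Ne Nc mulr1.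
have ecy : 6 <= Re (e * c * y) by rewrite [e * c]mulrC -mulrA.
have ynorm := bound _ y Nec.
have v0 : y - shift b != 0.
  by rewrite -normc_gt0; have := normcB_le y (shift b); lra.
(* A forbidden direction e c would force Re (e c y) <= 1/2 + 2, but it is at least 6. *)
have nU : ~ U (e * c).
  move=> Uec; have := bound _ (shift b) Nec.
  have := Uout (y - shift b) v0; rewrite -xv => /(_ ex _ Uec).
  by rewrite mulrBr complexReD complexReN; lra.
(* Of the two opposite directions perpendicular to e c, at least one is not in [U]. *)
have [t nUt] : exists t : bool, ~ U (e * c * (0 +i* - (-1) ^+ t)).
  have [Ut|Ut] := pselect (U (e * c * (0 +i* - (-1) ^+ false))); last by exists false.
  exists true; have := Uopp _ Ut; rewrite -mulrN expr0 expr1 opprK.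
  by have -> : - (0 +i* (-1)) = 0 +i* 1 :> R[i] by rewrite -[LHS]/(- 0 +i* - - 1) oppr0 opprK.
exists t; set be : R := (-1) ^+ t in nUt *.
have be1 : be * be = 1 by rewrite /be; case: (t); rewrite ?expr0 ?expr1 ?mulrNN mulr1.
set h := 10 * c^-1 * _.
have ch : c * h = 10 +i* (10 * be).
  by rewrite /h !mulrA [c * 10]mulrC mulfK //; apply: complex_ext; rewrite !ReImE /=; ring.
have v3 : 3 <= Normc.normc (e * h - shift b).
  have := normcB_le (e * h) (shift b); rewrite Normc.normcM Ne mul1r.
  have := Re_le_normc (c * h); rewrite Normc.normcM Nc mul1r ch /= ger0_norm //.
  lra.
have -> : cfrac b 0 + (-1) ^+ size b / (Q * h) = cfrac b (e * h - shift b)^-1.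
  rewrite cfrac_far // ?subrK; last by lra.
  by rewrite QE mulrACA ee mul1r.
apply: Uin => // k Uk; have [gk k1] := U1 _ Uk.
have := bound _ (shift b) (gaussian_normc1 k1).
(* This is [k] in the frame where e c becomes 1. The values 1 and -i [be] are not in [U]; for the
   other two units the real part of k e h is -10, which [shift b] cannot raise to 1/2. *)
set mu := k * e * c^-1.
have kE : k = e * c * mu by rewrite /mu; transitivity (e * e * k); [rewrite ee mul1r|field].
have gmu : gaussian_int mu by apply: gaussianM => //; apply: gaussianM.
have mu1 : sqnorm mu = 1.
  have : sqnorm e = 1 by rewrite -sqr_normc Ne expr1n.
  by rewrite /mu !sqnormM sqnormV k1 c1 => ->; rewrite invr1 !mulr1.
have keh : k * (e * h) = mu * (c * h).
  by rewrite {1}kE; transitivity (e * e * (mu * (c * h))); [ring|rewrite ee mul1r].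
rewrite mulrBr complexReD complexReN keh ch (complexReM mu) /=.
have [[m1 m2]|[m1 m2]] := gaussian_unitP gmu mu1; rewrite ?m1 ?m2 ?mul0r ?subr0 ?sub0r.
  have [m3|m3] := ler0P (Re mu); first by move: m1; rewrite ler0_norm //; lra.
  move: m1; rewrite gtr0_norm // => m1 _; case: nU.
  have -> : e * c = k; last by [].
  by rewrite kE (_ : mu = 1) ?mulr1 //; exact: complex_ext.
have [m3|m3] := eqVneq (Im mu) (- be).
  move=> _; case: nUt.
  have -> : 0 +i* - be = mu by apply: complex_ext; rewrite ?m1 ?m3.
  by rewrite -kE.
have -> : Im mu = be.
  have : (Im mu - be) * (Im mu + be) = 0.
    have : Im mu ^+ 2 = 1 by rewrite -(real_normK (num_real _)) m2 expr1n.
    by rewrite expr2 => i1; ring: i1 be1.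
  by move/eqP; rewrite mulf_eq0 subr_eq0 addr_eq0 (negbTE m3) orbF => /eqP.
by lra.
Qed.

End Counting.

(** * Transfer of the axis direction to a neighbouring set *)

Section Neighbours.
Variable R : realType.
Local Notation Re := complex.Re.
Local Notation Im := complex.Im.

Lemma near_diagonal n (a b : n.-tuple R[i]) (l u delta : R) (z x z' Y c : R[i]) :
  regular_word a -> regular_word b -> 11 < l -> 22 * u < 50 * l ->
  delta <= 1 / 500 / ((l - 5 / 2) * sqnorm (den a)) ->
  reduced a -> is_coord a Y z' -> Normc.normc (z - z') < delta ->
  l - 5 / 2 <= supnorm Y -> Normc.normc Y <= 3 / 2 * u + 3 ->
  annular_union b l u x -> Normc.normc (z - x) < delta ->
  gaussian_int c -> sqnorm c = 1 -> Re (c * Y) = supnorm Y ->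
  exists t : bool, expands b (cfrac a 0 +
    (-1) ^+ n / (den a ^+ 2 * (10 * c^-1 * (1 +i* (-1) ^+ t)))).
Proof.
move=> rega regb l11 ul deltaE ra cY zz' Y1 Y2 xS zx gc c1 cYE.
have [rb [x' [y [cy zx' y1 y2]]]] := annular_union_approx regb l11 xS zx.
have Y3 := supnorm_le_normc Y; have y3 := supnorm_le_normc y.
have qa : 0 < sqnorm (den a) by rewrite sqnorm_gt0 reduced_den_neq0.
have zx'' : Normc.normc (z' - x') <= 1 / 250 / (l - 5 / 2) / sqnorm (den a).
  have := normcD (z' - z) (z - x'); rewrite addrA subrK (normcBC z').
  by move: deltaE; rewrite invfM; lra.
have center : cfrac b 0 = cfrac a 0.
  apply: (same_center ra rb _ cY cy); rewrite ?size_tuple //; [lra|lra|].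
  apply: le_trans zx'' _; rewrite invfM ler_pM2r ?invr_gt0 // -mulrA mul1r.
  rewrite -invfM lef_pV2 ?posrE; lra.
have [e e1 QE] := den_sqr rb ra center.
have q0 : den a != 0 := reduced_den_neq0 ra.
have e0 : e != 0 by case: e1 => ->; rewrite ?oppr_eq0 oner_neq0.
have Ne : Normc.normc e = 1 by case: e1 => ->; rewrite ?normc_opp; exact: Normc.normc1.
have y0 : y != 0 by rewrite -normc_gt0; lra.
have Y0 : Y != 0 by rewrite -normc_gt0; lra.
have Nc := gaussian_normc1 c1.
(* Subtracting the two inversions gives |e y - Y| = |z' - x'| |q|^2 |y| |Y|. Both moduli are at most
   3u/2 + 3 <= 4l, and the remaining factor is at most 1/(160 l). *)
have diff : Normc.normc (e * y - Y) <= l / 10.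
  have [zE _ _] := cY; have [xE _ _] := cy.
  have E : (e * y - Y) * (-1) ^+ n = (z' - x') * (den a ^+ 2) * (e * y * Y).
    rewrite zE xE center QE !size_tuple; field.
    by rewrite q0 e0 y0 Y0.
  have := congr1 (@Normc.normc R) E; rewrite Normc.normcM normc_sign mulr1 => ->.
  rewrite !Normc.normcM Ne mul1r -expr2 sqr_normc.
  have h1 : Normc.normc (z' - x') * sqnorm (den a) <= 1 / 250 / (l - 5 / 2).
    by rewrite -ler_pdivlMr.
  have h2 : 1 / 250 / (l - 5 / 2) <= 1 / 160 / l.
    rewrite ler_pdivrMr; last by lra.
    rewrite mulrAC ler_pdivlMr; lra.
  have h3 : Normc.normc y * Normc.normc Y <= (4 * l) * (4 * l).
    by apply: ler_pM; rewrite ?normc_ge0 //; lra.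
  have -> : l / 10 = 1 / 160 / l * ((4 * l) * (4 * l)) by field; lra.
  apply: ler_pM => //; rewrite ?mulr_ge0 ?normc_ge0 ?sqnorm_ge0 //.
  exact: le_trans h1 h2.
(* The real part is at least l - 5/2 - l/10, which exceeds 6 for l > 11. *)
have ey : 6 <= Re (c * (e * y)).
  have -> : c * (e * y) = c * Y + c * (e * y - Y) by ring.
  have := Re_le_normc (c * (e * y - Y)); rewrite Normc.normcM Nc mul1r complexReD cYE.
  by rewrite ler_norml; lra.
have sb : {in b, forall d, digit d} by move=> d /tnthP[j ->]; case: regb.
have [|t ht] := sector_diagonal sb (regular_fat regb) rb gc c1 cy (Q := den a ^+ 2)
    (ex_intro2 _ _ e e1 (conj QE ey)).
  by rewrite expf_neq0.
by exists t; move: ht; rewrite center size_tuple.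
Qed.

End Neighbours.

Theorem theorem5p14 (R : realType) :
  exists rho : R, 0 < rho /\
    forall (l u : R), 11 < l -> l < u -> 22 / 50 < l / u -> l / u < 28 / 50 ->
    forall (n : nat) (a : n.-tuple R[i]), regular_word a ->
    forall z : R[i]^o, annular_union a l u z ->
      ([set X : set R[i]^o |
         (exists2 c : n.-tuple R[i], regular_word c & X = annular_union c l u) /\
         disc z (rho * diameter (annular_union a l u)) `&` X !=set0] #<= `I_2)%card.
Proof.
(* The diameter is at most 2/((l - 5/2) |q|^2), so this choice gives the bound on [delta] required
   by [near_diagonal]. *)
exists (1 / 1000); split; first by lra.
move=> l u l11 lu lu1 _ n a rega z zS.
have ul : 22 * u < 50 * l.
  by move: lu1; rewrite ltr_pdivlMr; lra.
set delta := _ * diameter _.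
have deltaE : delta <= 1 / 500 / ((l - 5 / 2) * sqnorm (den a)).
  by have := diameter_annular_union rega l11 zS; rewrite /delta; lra.
apply: card_le2 => _ _ _ [[b1 r1 ->] [x1 [d1 h1]]] [[b2 r2 ->] [x2 [d2 h2]]]
  [[b3 r3 ->] [x3 [d3 h3]]].
rewrite /disc !ball_normc in d1 d2 d3.
(* The disc contains a point, so its radius is positive. *)
have d0 : Normc.normc (z - z) < delta.
  rewrite subrr; have -> : Normc.normc (0 : R[i]) = 0 := Normc.normc0 R.
  by apply: le_lt_trans d1; exact: normc_ge0.
have [ra [z' [Y [cY zz' Y1 Y2]]]] := annular_union_approx rega l11 zS d0.
(* The direction is taken from the word [a] and serves all three neighbours. *)
have [c [gc c1 cYE]] := supnorm_direction Y.
have diag b x (rb : regular_word b) xS dx := near_diagonal (b := b) (x := x)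
  rega rb l11 ul deltaE ra cY zz' Y1 Y2 xS dx gc c1 cYE.
have same (b b' : n.-tuple R[i]) w : expands b w -> expands b' w ->
    annular_union b l u = annular_union b' l u.
  by move=> h h'; congr annular_union; apply/val_inj/(expands_inj _ h h'); rewrite !size_tuple.
(* Two of the three bits agree; the two words then expand a common point, so they are equal. *)
have [[] t1] := diag b1 x1 r1 h1 d1; have [[] t2] := diag b2 x2 r2 h2 d2;
  have [[] t3] := diag b3 x3 r3 h3 d3;
  by [apply: Or31; exact: same t1 t2 | apply: Or32; exact: same t1 t3 |
      apply: Or33; exact: same t2 t3].
Qed.
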